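(* Let $G$ be the Grigorchuk group, let $(G,X)$ be its self-similar action on words in $X=\{0,1\}$, and let $\mathcal{G}_{G,X}$ be the associated groupoid. Let $\mathbb{Z}_2$ be the field with two elements. Then the set $\mathcal{S}_{\mathbb{Z}_2}(\mathcal{G}_{G,X})$ of singular elements is nonzero (i.e. contains a nonzero element), and hence the Steinberg algebra $A_{\mathbb{Z}_2}(\mathcal{G}_{G,X})$ is not simple.
   Context: Grigorchuk group. Let $X=\{0,1\}$, $X^*$ the set of finite words in $X$ including the empty word $\varnothing$, and $X^\omega$ the Cantor space of one-sided infinite words, with clopen basis $C(\alpha)=\{\alpha x:x\in X^\omega\}$. $G$ is the group generated by the length-preserving bijections $a,b,c,d$ of $X^*$ (fixing $\varnothing$) determined by $a\cdot(0w)=1w$, $a\cdot(1w)=0w$, $b\cdot(0w)=0(a\cdot w)$, $b\cdot(1w)=1(c\cdot w)$, $c\cdot(0w)=0(a\cdot w)$, $c\cdot(1w)=1(d\cdot w)$, $d\cdot(0w)=0w$, $d\cdot(1w)=1(b\cdot w)$ for $w\in X^*$; its identity is $e$. For $g\in G$ and $x\in X$ there is a unique $g|_x\in G$ with $g\cdot(x\alpha)=(g\cdot x)(g|_x\cdot\alpha)$ for all $\alpha\in X^*$; restriction extends to words by $g|_{\alpha_1\cdots\alpha_n}=g|_{\alpha_1}|_{\alpha_2}\cdots|_{\alpha_n}$, so $g\cdot(\alpha\beta)=(g\cdot\alpha)(g|_\alpha\cdot\beta)$; the action extends to $X^\omega$ prefix by prefix. Groupoid. $S_{G,X}=\{(\alpha,g,\beta):\alpha,\beta\in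 X^*,g\in G\}\cup\{0\}$ is the inverse semigroup with $(\alpha,g,\beta)(\gamma,h,\nu)=(\alpha(g\cdot\varepsilon),g|_\varepsilon h,\nu)$ if $\gamma=\beta\varepsilon$, $=(\alpha,g(h^{-1}|_\varepsilon)^{-1},\nu(h^{-1}\cdot\varepsilon))$ if $\beta=\gamma\varepsilon$, and $0$ otherwise; $(\alpha,g,\beta)^*=(\beta,g^{-1},\alpha)$. It acts on $X^\omega$ by $\theta_{(\alpha,g,\beta)}:C(\beta)\to C(\alpha)$, $\beta w\mapsto\alpha(g\cdot w)$. $\mathcal{G}_{G,X}$ is the groupoid of germs $[s,x]$, $s=(\alpha,g,\beta)$, $x\in C(\beta)$, with $[s,x]=[t,y]$ iff $x=y$ and $s(\mu,e,\mu)=t(\mu,e,\mu)$ for some prefix $\mu$ of $x$; source $x$, range $\theta_s(x)$ (unit space $X^\omega$), $[u,\theta_t(x)][t,x]=[ut,x]$, $[t,x]^{-1}=[t^*,\theta_t(x)]$. A basis of its topology is given by the compact open bisections $\Theta((\alpha,g,\beta),C(\beta\eta))=\{[(\alpha,g,\beta),x]:x\in C(\beta\eta)\}$, so it is ample (it is not Hausdorff). An open bisection is an open set on which $r$ and $s$ restrict to homeomorphisms onto open subsets of the unit space. Algebra. For a field $\mathbb{K}$, $A_{\mathbb{K}}(\mathcal{G}_{G,X})$ is the $\mathbb{K}$-linear span of characteristic functions of compact open bisections, with convolution $f*g(\gamma)=\sum_{r(\eta)=r(\gamma)}f(\eta)g(\eta^{-1}\gamma)$. An element $f$ is singular if it can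 be written $f=\sum_{i=1}^nc_i1_{M_i}$ with $c_i\in\mathbb{K}$ and pairwise disjoint sets $M_i$, each of which is a relatively closed subset of some open bisection and has empty interior; $\mathcal{S}_{\mathbb{K}}(\mathcal{G}_{G,X})$ is the set of singular elements. Simple means no two-sided ideals other than $0$ and the whole algebra. *)

(* Defs.v *)
From HB Require Import structures.
From mathcomp Require Import all_boot all_order all_algebra.
From mathcomp Require Import generic_quotient.
From mathcomp Require Import boolp classical_sets functions fsbigop.
From mathcomp Require Import topology cantor numfun.

Set Implicit Arguments.
Unset Strict Implicit.
Unset Printing Implicit Defensive.

Import GRing.Theory.
Local Open Scope classical_set_scope.
Local Open Scope quotient_scope.

(* The letters 0 and 1 are encoded by [false] and [true]. *)
Definition word := seq bool.

Definition grig_a (w : word) : word := if w is x :: v then ~~ x :: v else [::].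

Fixpoint grig_b (w : word) : word :=
  match w with
  | [::] => [::]
  | false :: v => false :: grig_a v
  | true :: v => true :: grig_c v
  end
with grig_c (w : word) : word :=
  match w with
  | [::] => [::]
  | false :: v => false :: grig_a v
  | true :: v => true :: grig_d v
  end
with grig_d (w : word) : word :=
  match w with
  | [::] => [::]
  | false :: v => false :: v
  | true :: v => true :: grig_b v
  end.

Inductive in_grig : (word -> word) -> Prop :=
| in_grig1 : in_grig id
| in_griga : in_grig grig_a
| in_grigb : in_grig grig_b
| in_grigc : in_grig grig_c
| in_grigd : in_grig grig_d
| in_grigM g h : in_grig g -> in_grig h -> in_grig (g \o h)
| in_grigV g h : in_grig g -> cancel g h -> cancel h g -> in_grig h.

Record grigorchuk :=
  Grigorchuk { grig_act :> word -> word; grig_actP : in_grig grig_act }.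

HB.instance Definition _ := gen_eqMixin grigorchuk.
HB.instance Definition _ := gen_choiceMixin grigorchuk.

Lemma grig_ext (g h : grigorchuk) : g =1 h -> g = h.
Proof.
case: g h => [g gP] [h hP] /= /funext E; move: gP hP; rewrite E => gP hP.
by congr Grigorchuk; exact: Prop_irrelevance.
Qed.

Lemma grig_aK : involutive grig_a.
Proof. by case=> [//|x w] /=; rewrite negbK. Qed.

Lemma grig_bcdK w :
  [/\ grig_b (grig_b w) = w, grig_c (grig_c w) = w & grig_d (grig_d w) = w].
Proof.
by elim: w => [//|[] w [IHb IHc IHd]]; split => //=;
  rewrite ?IHb ?IHc ?IHd ?grig_aK.
Qed.

Lemma grig_inv_exists (g : grigorchuk) :
  exists h : grigorchuk, cancel g h /\ cancel h g.
Proof.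
case: g => g gP /=.
suff [h [hP gK hK]] : exists h, [/\ in_grig h, cancel g h & cancel h g].
  by exists (Grigorchuk hP).
elim: gP => {g} [|||||g1 g2 _ [h1 [P1 K1 L1]] _ [h2 [P2 K2 L2]]|g h gP _ gK hK].
- by exists id; split=> //; constructor.
- by exists grig_a; split; [constructor|exact: grig_aK..].
- by exists grig_b; split=> [|w|w]; [constructor|case: (grig_bcdK w)..].
- by exists grig_c; split=> [|w|w]; [constructor|case: (grig_bcdK w)..].
- by exists grig_d; split=> [|w|w]; [constructor|case: (grig_bcdK w)..].
- exists (h2 \o h1); split; [by constructor|exact: can_comp..].
- by exists g; split.
Qed.

Definition grig_one : grigorchuk := Grigorchuk in_grig1.
Definition grig_mul (g h : grigorchuk) : grigorchuk :=
  Grigorchuk (in_grigM (grig_actP g) (grig_actP h)).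
Definition grig_inv (g : grigorchuk) : grigorchuk :=
  projT1 (cid (grig_inv_exists g)).

Lemma grig_actK (g : grigorchuk) : cancel g (grig_inv g).
Proof. by rewrite /grig_inv; case: cid => h []. Qed.

Lemma grig_actVK (g : grigorchuk) : cancel (grig_inv g) g.
Proof. by rewrite /grig_inv; case: cid => h []. Qed.

Lemma grig_mulA : associative grig_mul.
Proof. by move=> f g h; apply: grig_ext. Qed.
Lemma grig_mul1 : left_id grig_one grig_mul.
Proof. by move=> g; apply: grig_ext. Qed.
Lemma grig_mulr1 : right_id grig_one grig_mul.
Proof. by move=> g; apply: grig_ext. Qed.
Lemma grig_mulV : left_inverse grig_one grig_inv grig_mul.
Proof. by move=> g; apply: grig_ext => w /=; exact: grig_actK. Qed.
Lemma grig_mulrV : right_inverse grig_one grig_inv grig_mul.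
Proof. by move=> g; apply: grig_ext => w /=; exact: grig_actVK. Qed.

HB.instance Definition _ := isGroup.Build grigorchuk
  grig_mulA grig_mul1 grig_mulr1 grig_mulV grig_mulrV.

Lemma in_grig_size g : in_grig g -> forall w, size (g w) = size w.
Proof.
have bcd v : [/\ size (grig_b v) = size v, size (grig_c v) = size v
    & size (grig_d v) = size v].
  elim: v => [//|[] v [IHb IHc IHd]]; split => //=; rewrite ?IHb ?IHc ?IHd //.
    by case: v {IHb IHc IHd}.
  by case: v {IHb IHc IHd}.
elim=> {g} [//||||| g h _ IHg _ IHh w /= | g h _ IHg gK hK w].
- by case.
- by move=> w; case: (bcd w).
- by move=> w; case: (bcd w).
- by move=> w; case: (bcd w).
- by rewrite IHg IHh.
- by rewrite -{2}(hK w) IHg.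
Qed.

Lemma in_grig_take g : in_grig g -> forall w n, g (take n w) = take n (g w).
Proof.
have ta v n : grig_a (take n v) = take n (grig_a v) by case: v n => [|x v] [].
have bcd v : forall n, [/\ grig_b (take n v) = take n (grig_b v),
    grig_c (take n v) = take n (grig_c v)
    & grig_d (take n v) = take n (grig_d v)].
  elim: v => [//|x v IH] [|n].
    by case: x.
  by case: x; case: (IH n) => Hb Hc Hd; split => //=; rewrite ?Hb ?Hc ?Hd ?ta.
elim=> {g} [//|//|||| g h _ IHg _ IHh w n /= | g h _ IHg gK hK w n].
- by move=> w n; case: (bcd w n).
- by move=> w n; case: (bcd w n).
- by move=> w n; case: (bcd w n).
- by rewrite IHh IHg.
- by rewrite -{1}(hK w) -IHg gK.
Qed.

Lemma in_grig_cons g x w : in_grig g ->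
  g (x :: w) = head x (g [:: x]) :: behead (g (x :: w)).
Proof.
move=> gP; have /= := in_grig_take gP (x :: w) 1; rewrite take0.
by move=> ->; have := in_grig_size gP (x :: w); case: (g _).
Qed.

Lemma in_grig_restr g x : in_grig g -> in_grig (fun w => behead (g (x :: w))).
Proof.
move=> gP; elim: gP x => {g} [|||||g h gP IHg hP IHh|g h gP IHg gK hK] x.
- exact: in_grig1.
- exact: in_grig1.
- by case: x; [exact: in_grigc|exact: in_griga].
- by case: x; [exact: in_grigd|exact: in_griga].
- by case: x; [exact: in_grigb|exact: in_grig1].
- rewrite [X in in_grig X](_ : _ =
    (fun w => behead (g (head x (h [:: x]) :: w)))
    \o (fun w => behead (h (x :: w)))); first exact: in_grigM.
  by apply: funext => w /=; rewrite (in_grig_cons x w hP).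
- have hP := in_grigV gP gK hK.
  set y := head x (h [:: x]).
  have yE w : h (x :: w) = y :: behead (h (x :: w)) by exact: in_grig_cons.
  have xE w : g (y :: w) = x :: behead (g (y :: w)).
    rewrite (in_grig_cons y w gP); congr (_ :: _).
    have := in_grig_take gP (h [:: x]) 1; rewrite hK (yE [::]) /= take0.
    by move=> ->.
  apply: (in_grigV (IHg y)) => w.
    by rewrite -xE gK.
  by rewrite -yE hK.
Qed.

(* g|_x for a letter x, characterized by [grig_letterE] below. *)
Definition restr1 (g : grigorchuk) (x : bool) : grigorchuk :=
  Grigorchuk (in_grig_restr x (grig_actP g)).

Definition restr (g : grigorchuk) (v : word) : grigorchuk := foldl restr1 g v.

Lemma grig_letterE (g : grigorchuk) x w : g (x :: w) = g [:: x] ++ restr1 g x w.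
Proof.
rewrite (in_grig_cons x w (grig_actP g)) /=.
by have := in_grig_size (grig_actP g) [:: x]; case: (g _) => [|y []].
Qed.

Lemma grig_nil (g : grigorchuk) : g [::] = [::].
Proof. by apply: size0nil; rewrite in_grig_size //; exact: grig_actP. Qed.

Lemma restr_cat (g : grigorchuk) v w : g (v ++ w) = g v ++ restr g v w.
Proof.
elim: v g => [|x v IH] g /=; first by rewrite grig_nil.
by rewrite grig_letterE IH catA -(grig_letterE g x v).
Qed.

(* The space of one-sided infinite words with the product topology, for which *)
(* the cylinders below are a basis of clopen sets.                            *)
Notation infword := cantor_space.

Definition cat_inf (v : word) (x : infword) : infword :=
  fun n => nth (x (n - size v)) v n.

Definition take_inf (n : nat) (x : infword) : word := mkseq x n.

Definition drop_inf (n : nat) (x : infword) : infword := fun i => x (n + i).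

Definition cylinder (v : word) : set infword := range (cat_inf v).

(* The n-th letter of g . x is determined by the prefix of x of length n+1. *)
Definition act_inf (g : grigorchuk) (x : infword) : infword :=
  fun n => nth false (g (take_inf n.+1 x)) n.

(* [Triple al g be] is the element (al, g, be) of S_{G,X}. *)
Record triple :=
  Triple { t_tgt : word; t_elt : grigorchuk; t_src : word }.

HB.instance Definition _ := gen_eqMixin triple.
HB.instance Definition _ := gen_choiceMixin triple.

(* The inverse semigroup S_{G,X}, with [None] for 0. *)
Definition sgx := option triple.

Definition triple_mul (s t : triple) : sgx :=
  let: Triple al g be := s in
  let: Triple ga h nu := t in
  if prefix be ga then
    let ep := drop (size be) ga in
    Some (Triple (al ++ g ep) (restr g ep * h)%g nu)
  else if prefix ga be then
    let ep := drop (size ga) be in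
    Some (Triple al (g * (restr h^-1 ep)^-1)%g (nu ++ (h^-1)%g ep))
  else None.

Definition sgx_mul (s t : sgx) : sgx :=
  if s is Some s' then if t is Some t' then triple_mul s' t' else None else None.

Definition triple_star (s : triple) : triple :=
  Triple (t_src s) (t_elt s)^-1%g (t_tgt s).

Definition idem (mu : word) : triple := Triple mu 1%g mu.

(* Meaningful on [cylinder (t_src s)] only. *)
Definition theta (s : triple) (x : infword) : infword :=
  cat_inf (t_tgt s) (act_inf (t_elt s) (drop_inf (size (t_src s)) x)).

Definition pregerm := {p : triple * infword | `[< cylinder (t_src p.1) p.2 >]}.

Definition germ_rel (p q : pregerm) : bool :=
  `[< (val p).2 = (val q).2 /\
      exists n, let mu := idem (take_inf n (val p).2) in
        triple_mul (val p).1 mu = triple_mul (val q).1 mu >].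

Lemma take_inf_size n x : size (take_inf n x) = n.
Proof. exact: size_mkseq. Qed.

Lemma take_infP (x y : infword) :
  (forall n, take_inf n x = take_inf n y) -> x = y.
Proof.
move=> E; apply: funext => n.
by have := congr1 (nth false ^~ n) (E n.+1); rewrite !nth_mkseq.
Qed.

Lemma take_inf_le m n x : m <= n -> take m (take_inf n x) = take_inf m x.
Proof.
move=> mn; apply: (@eq_from_nth _ false).
  by rewrite size_takel take_inf_size.
move=> i; rewrite size_takel ?take_inf_size // => im.
by rewrite nth_take // !nth_mkseq // (leq_trans im).
Qed.

Lemma cat_take_drop_inf n x : cat_inf (take_inf n x) (drop_inf n x) = x.
Proof.
apply: funext => i; rewrite /cat_inf take_inf_size /drop_inf.
case: (ltnP i n) => ni; first by rewrite nth_mkseq.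
by rewrite nth_default ?take_inf_size // subnKC.
Qed.

Lemma drop_cat_inf v x : drop_inf (size v) (cat_inf v x) = x.
Proof.
apply: funext => i; rewrite /drop_inf /cat_inf addKn nth_default //.
exact: leq_addr.
Qed.

Lemma take_cat_inf v x : take_inf (size v) (cat_inf v x) = v.
Proof.
apply: (@eq_from_nth _ false); rewrite take_inf_size // => i iv.
by rewrite nth_mkseq // /cat_inf; exact: set_nth_default.
Qed.

Lemma cat_infA u v x : cat_inf (u ++ v) x = cat_inf u (cat_inf v x).
Proof.
apply: funext => i; rewrite /cat_inf nth_cat size_cat subnDA.
case: ltnP => // iu; first exact: set_nth_default.
by rewrite [in RHS]nth_default.
Qed.

Lemma cylinderE v x : cylinder v x <-> take_inf (size v) x = v.
Proof.
split; first by case=> y _ <-; exact: take_cat_inf.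
by move=> <-; exists (drop_inf (size v) x); rewrite ?take_inf_size ?cat_take_drop_inf.
Qed.

Lemma cylinder_take n x : cylinder (take_inf n x) x.
Proof. by apply/cylinderE; rewrite take_inf_size. Qed.

Lemma open_infwordE (A : set infword) : open A <->
  forall x, A x -> exists v, cylinder v x /\ cylinder v `<=` A.
Proof.
have cyl_nbhs x n : nbhs x (cylinder (take_inf n x)).
  suff H : forall i, (i < n)%N -> nbhs x [set y : infword | y i = x i].
    have : nbhs x [set y : infword | forall i : 'I_n, y i = x i].
      have FF : Filter (nbhs x) by exact: nbhs_filter.
      by apply: (@filter_forall _ _ (fun (i : 'I_n) => [set y : infword | y i = x i]) (nbhs x) FF) => i; exact: H.
    apply: filterS => y E; apply/cylinderE; rewrite take_inf_size.
    by apply/eq_in_map => i; rewrite mem_iota => /= lin; exact: (E (Ordinal lin)).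
  move=> i _; apply: (@proj_continuous nat (fun=> bool) i x [set b | b = x i]).
  apply: open_nbhs_nbhs; split=> //; exact: discrete_open.
split=> [oA x Ax|H].
  apply: contrapT => /forallNP nA.
  have {}nA n : exists y : infword, cylinder (take_inf n x) y /\ ~ A y.
    have := nA (take_inf n x); move/not_andP => [/(_ (cylinder_take n x))//|].
    by move=> /existsNP[y /not_implyP[]]; exists y.
  have [y yP] := choice nA.
  have yx : y @ \oo --> x.
    apply/cvg_sup => i U [_ [[V _ <-] /= Vx]] /filterS; apply.
    exists i.+1 => // n /= lin; have [/cylinderE E _] := yP n.
    rewrite take_inf_size in E; have := congr1 (nth false ^~ i) E.
    by rewrite !nth_mkseq //= => ->.
  have /yx [N _ /(_ N (leqnn N)) AyN] : nbhs x A by exact: open_nbhs_nbhs.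
  by case: (yP N) => _; apply.
rewrite openE => x /H[v [/cylinderE vx vA]]; rewrite /interior.
by apply: filterS vA _; rewrite -vx.
Qed.

Lemma take_act_inf (g : grigorchuk) n x :
  take_inf n (act_inf g x) = g (take_inf n x).
Proof.
have gP := grig_actP g.
apply: (@eq_from_nth _ false); first by rewrite take_inf_size in_grig_size // take_inf_size.
move=> i; rewrite take_inf_size => lin.
rewrite nth_mkseq // /act_inf -(@take_inf_le i.+1 n) //.
by rewrite in_grig_take // nth_take.
Qed.

Lemma act_inf1 x : act_inf 1%g x = x.
Proof. by apply: take_infP => n; rewrite take_act_inf. Qed.

Lemma act_infM g h x : act_inf (g * h)%g x = act_inf g (act_inf h x).
Proof. by apply: take_infP => n; rewrite !take_act_inf. Qed.

Lemma take_cat_infD v m x : take_inf (size v + m) (cat_inf v x) = v ++ take_inf m x.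
Proof.
apply: (@eq_from_nth _ false); first by rewrite size_cat !take_inf_size.
move=> i; rewrite take_inf_size => im.
rewrite nth_mkseq // /cat_inf nth_cat.
case: ltnP => iv; first exact: set_nth_default.
by rewrite nth_default // nth_mkseq // ltn_subLR.
Qed.

Lemma act_inf_cat (g : grigorchuk) v x :
  act_inf g (cat_inf v x) = cat_inf (g v) (act_inf (restr g v) x).
Proof.
have sg : size (g v) = size v := in_grig_size (grig_actP g) v.
rewrite -[LHS](cat_take_drop_inf (size v)) take_act_inf take_cat_inf.
congr cat_inf; apply: take_infP => n.
have := take_act_inf g (size v + n) (cat_inf v x).
rewrite take_cat_infD restr_cat.
rewrite -{1}(cat_take_drop_inf (size v) (act_inf g (cat_inf v x))).
rewrite take_act_inf take_cat_inf -{1}sg take_cat_infD.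
by move/eqP; rewrite eqseq_cat // eqxx /= take_act_inf => /eqP.
Qed.

Lemma act_inf_inj (g h : grigorchuk) : act_inf g =1 act_inf h -> g = h.
Proof.
move=> E; apply: grig_ext => w.
have := take_act_inf g (size w) (cat_inf w (fun=> false)).
by rewrite E take_act_inf take_cat_inf => ->.
Qed.

Lemma cat_infI v : injective (cat_inf v).
Proof. by move=> x y E; rewrite -(drop_cat_inf v x) E drop_cat_inf. Qed.

Lemma theta_cat al g be x : theta (Triple al g be) (cat_inf be x) = cat_inf al (act_inf g x).
Proof. by rewrite /theta /= drop_cat_inf. Qed.

Lemma thetaK s x : cylinder (t_src s) x -> theta (triple_star s) (theta s x) = x.
Proof.
case: s => al g be /= [y _ <-]; rewrite theta_cat theta_cat -act_infM.
by rewrite mulVg act_inf1.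
Qed.

Lemma theta_tgt s x : cylinder (t_tgt s) (theta s x).
Proof. by eexists. Qed.

Lemma triple_mulP s t x :
  cylinder (t_src t) x -> cylinder (t_src s) (theta t x) ->
  exists u, [/\ triple_mul s t = Some u, cylinder (t_src u) x
    & forall y, cylinder (t_src u) y ->
      [/\ cylinder (t_src t) y, cylinder (t_src s) (theta t y)
        & theta u y = theta s (theta t y)]].
Proof.
case: s t => al g be [ga h nu] /= [x' _ <-]; rewrite theta_cat => /cylinderE be_p.
rewrite /triple_mul; case: ifP => [/prefixP[ep gaE]|npre].
  rewrite gaE drop_size_cat //; eexists; split=> //=; first by exists x'.
  move=> y [y' _ <-]; split; first by exists y'.
    by rewrite theta_cat cat_infA; eexists.
  by rewrite !theta_cat !cat_infA theta_cat act_inf_cat act_infM.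
have lt : size ga <= size be.
  rewrite leqNgt; apply/negP => /ltnW /subnKC lt; move/negP: npre; apply.
  have := take_cat_inf ga (act_inf h x').
  rewrite -[X in take_inf X _]lt => gaE.
  rewrite prefixE -[X in take _ X]gaE take_inf_le ?leq_addr //.
  by rewrite be_p.
have [m beE] : exists m, be = ga ++ take_inf m (act_inf h x').
  exists (size be - size ga); rewrite -take_cat_infD subnKC //.
rewrite beE prefix_prefix drop_size_cat //; set ep := take_inf _ _.
have hV : cancel (h^-1)%g h := grig_actVK h.
have hep : (h^-1)%g ep = take_inf m x'.
  by rewrite /ep take_act_inf; exact: grig_actK.
have hact y : act_inf h (cat_inf ((h^-1)%g ep) y)
     = cat_inf ep (act_inf ((restr h^-1 ep)^-1)%g y).
  have := act_inf_cat (h^-1)%g ep (act_inf (restr h^-1 ep)^-1%g y).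
  rewrite -act_infM mulgV act_inf1 => <-.
  by rewrite -act_infM mulgV act_inf1.
eexists; split=> //=.
  rewrite hep -{2}(cat_take_drop_inf m x') -cat_infA; by eexists.
move=> y [y' _ <-]; rewrite !cat_infA; split; first by eexists.
  by rewrite theta_cat hact -cat_infA; eexists.
rewrite [in RHS]theta_cat hact -cat_infA theta_cat -cat_infA theta_cat.
by rewrite act_infM.
Qed.

Lemma cylinder_sub v n x y : cylinder v x -> size v <= n ->
  cylinder (take_inf n x) y -> cylinder v y.
Proof.
move=> /cylinderE vx vn /cylinderE; rewrite take_inf_size => E.
by apply/cylinderE; rewrite -(take_inf_le y vn) E take_inf_le.
Qed.

Lemma cylinder_take_le m n x y : m <= n ->
  cylinder (take_inf n x) y -> cylinder (take_inf m x) y.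
Proof.
move=> mn; apply: cylinder_sub; first exact: cylinder_take.
by rewrite take_inf_size.
Qed.

Lemma theta_idem mu x : cylinder mu x -> theta (idem mu) x = x.
Proof. by case=> y _ <-; rewrite theta_cat act_inf1. Qed.

Lemma cylinder_size u v : cylinder u `<=` cylinder v -> size v <= size u.
Proof.
move=> uv; rewrite leqNgt; apply/negP => lt.
have /uv/cylinderE E : cylinder u (cat_inf u (fun=> ~~ nth false v (size u))).
  by eexists.
have := congr1 (nth false ^~ (size u)) E.
rewrite nth_mkseq // /cat_inf nth_default //.
by case: (nth _ _ _).
Qed.

Lemma cylinder_inj u v : cylinder u = cylinder v -> u = v.
Proof.
move=> uv; have uv_size : size u = size v.
  by apply/eqP; rewrite eqn_leq !cylinder_size ?uv.
have /cylinderE : cylinder v (cat_inf u (fun=> false)).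
  by rewrite -uv; eexists.
by rewrite -uv_size take_cat_inf.
Qed.

Lemma theta_image s : theta s @` cylinder (t_src s) = cylinder (t_tgt s).
Proof.
apply/seteqP; split=> x; first by case=> y _ <-; exact: theta_tgt.
move=> sx; exists (theta (triple_star s) x); first exact: (theta_tgt (triple_star s)).
rewrite -[X in theta X _](_ : triple_star (triple_star s) = s) ?thetaK //.
by case: s {sx} => al g be; rewrite /triple_star /= invgK.
Qed.

Lemma triple_ext s t : t_src s = t_src t ->
  (forall x, cylinder (t_src s) x -> theta s x = theta t x) -> s = t.
Proof.
move=> Est E; have : t_tgt s = t_tgt t.
  apply: cylinder_inj; rewrite -!theta_image -Est.
  by apply/seteqP; split=> x [y sy <-]; exists y => //; rewrite E.
case: s t Est E => [al g be] [al' h be'] /= <- E Eal; rewrite -Eal in E *.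
congr Triple; apply: act_inf_inj => x; apply: (@cat_infI al).
by have := E (cat_inf be x); rewrite !theta_cat; apply; exists x.
Qed.

Lemma triple_mul_idem s n x : cylinder (t_src s) x -> size (t_src s) <= n ->
  exists u, [/\ triple_mul s (idem (take_inf n x)) = Some u,
    t_src u = take_inf n x
    & forall y, cylinder (take_inf n x) y -> theta u y = theta s y].
Proof.
move=> sx sn; have nx := cylinder_take n x.
have sx' : cylinder (t_src s) (theta (idem (take_inf n x)) x).
  by rewrite theta_idem.
have [u [uE ux uP]] := @triple_mulP s (idem (take_inf n x)) x nx sx'.
have Eu : t_src u = take_inf n x.
  move: uE; case: s sx sn {sx' uP} => al g be /= /cylinderE sx sn.
  by rewrite prefixE take_inf_le // sx eqxx => -[<-].
exists u; split=> // y ny; rewrite -Eu in ny.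
by have [ty _ ->] := uP y ny; rewrite theta_idem.
Qed.

Lemma germ_relP (p q : pregerm) : reflect
  ((val p).2 = (val q).2 /\
   exists n, forall y, cylinder (take_inf n (val p).2) y ->
     [/\ cylinder (t_src (val p).1) y, cylinder (t_src (val q).1) y
       & theta (val p).1 y = theta (val q).1 y])
  (germ_rel p q).
Proof.
case: p q => [[s x] sx0] [[t x'] tx0]; rewrite /germ_rel /=.
have /= sx := asboolW sx0; have /= tx := asboolW tx0.
apply: (iffP (asboolP _)) => -[E [n H]]; move: tx; rewrite -E => tx; split=> //.
- have nx := cylinder_take n x.
  have [||u [uE ux uP]] := @triple_mulP s (idem (take_inf n x)) x; rewrite ?theta_idem //.
  have [||v [vE vx vP]] := @triple_mulP t (idem (take_inf n x)) x; rewrite ?theta_idem //.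
  move: vE; rewrite -H uE => -[Euv]; subst v.
  exists (size (t_src u)) => y; rewrite (_ : take_inf _ _ = t_src u); last exact/cylinderE.
  move=> uy; have [ny] := uP y uy; have [_] := vP y uy.
  by rewrite theta_idem // => ? -> ? ->.
- set m := maxn n (maxn (size (t_src s)) (size (t_src t))).
  have [nm sm tm] : [/\ n <= m, size (t_src s) <= m & size (t_src t) <= m].
    by rewrite /m !leq_max !leqnn !orbT.
  exists m.
  have [u [-> su uP]] := triple_mul_idem sx sm.
  have [v [-> sv vP]] := triple_mul_idem tx tm.
  congr Some; apply: triple_ext; first by rewrite su.
  move=> y; rewrite su => my; rewrite uP // vP //.
  by have [] := H y (cylinder_take_le nm my).
Qed.

Lemma germ_rel_refl : reflexive germ_rel.
Proof. by move=> p; apply/asboolP; split=> //; exists 0. Qed.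

Lemma germ_rel_sym : symmetric germ_rel.
Proof.
suff sub p q : germ_rel p q -> germ_rel q p by move=> p q; apply/idP/idP => /sub.
move=> /asboolP[E [n H]]; apply/asboolP; split=> //; exists n.
by rewrite -E.
Qed.

Lemma germ_rel_trans : transitive germ_rel.
Proof.
move=> q p r /germ_relP[Epq [m Hm]] /germ_relP[Eqr [n Hn]].
apply/germ_relP; split; first by rewrite Epq.
exists (maxn m n) => y my.
rewrite -Epq in Hn.
have [sy _ ->] := Hm y (cylinder_take_le (leq_maxl _ _) my).
by have [_ ty ->] := Hn y (cylinder_take_le (leq_maxr _ _) my).
Qed.

Canonical germ_equiv :=
  EquivRel germ_rel germ_rel_refl germ_rel_sym germ_rel_trans.

Definition germ := {eq_quot germ_equiv}.
HB.instance Definition _ := Choice.on germ.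

Lemma pregerm0_subproof :
  `[< cylinder (t_src (Triple [::] 1%g [::])) (fun=> false) >].
Proof. by apply/asboolP/cylinderE. Qed.

Definition pregerm0 : pregerm := exist _ (_, _) pregerm0_subproof.

(* [germ_of s x] is the germ [s, x] if x lies in the domain C(be) of theta_s; *)
(* it is a dummy value otherwise.                                             *)
Definition germ_of (s : triple) (x : infword) : germ :=
  \pi_germ (insubd pregerm0 (s, x)).

Definition germ_triple (g : germ) : triple := (val (repr g)).1.

Definition germ_source (g : germ) : infword := (val (repr g)).2.

Definition germ_range (g : germ) : infword :=
  theta (germ_triple g) (germ_source g).

(* The product is meaningful on composable pairs only, and then [triple_mul]  *)
(* is never 0: see [germ_mulE].                                               *)
Definition germ_mul (g h : germ) : germ :=
  if triple_mul (germ_triple g) (germ_triple h) is Some u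
  then germ_of u (germ_source h) else \pi_germ pregerm0.

Definition germ_inv (g : germ) : germ :=
  germ_of (triple_star (germ_triple g)) (germ_range g).

Lemma germ_tripleP g : cylinder (t_src (germ_triple g)) (germ_source g).
Proof. exact: asboolW (valP (repr g)). Qed.

Lemma germE g : g = germ_of (germ_triple g) (germ_source g).
Proof.
rewrite -[LHS]reprK /germ_of; congr (\pi _); apply: val_inj.
by rewrite insubdK -?surjective_pairing //; exact: valP.
Qed.

Lemma germ_ofP s t x x' : cylinder (t_src s) x -> cylinder (t_src t) x' ->
  germ_of s x = germ_of t x' <->
  x = x' /\ exists n, forall y, cylinder (take_inf n x) y ->
    [/\ cylinder (t_src s) y, cylinder (t_src t) y & theta s y = theta t y].
Proof.
move=> sx tx; split.
  move/eqquotP/germ_relP; rewrite !insubdK //; exact/asboolP.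
by move=> H; apply/eqquotP/germ_relP; rewrite !insubdK //; exact/asboolP.
Qed.

Lemma germ_of_eq s t x x' : cylinder (t_src s) x -> cylinder (t_src t) x' ->
  germ_of s x = germ_of t x' <->
  x = x' /\ exists n, let mu := idem (take_inf n x) in
    triple_mul s mu = triple_mul t mu.
Proof.
move=> sx tx; split.
  move/eqquotP/asboolP; rewrite !insubdK //; exact/asboolP.
by move=> H; apply/eqquotP/asboolP; rewrite !insubdK //; exact/asboolP.
Qed.

Lemma germ_sourceE s x : cylinder (t_src s) x -> germ_source (germ_of s x) = x.
Proof.
move=> sx; have /germ_ofP := esym (germE (germ_of s x)).
by case=> //; exact: germ_tripleP.
Qed.

Lemma germ_rangeE s x : cylinder (t_src s) x ->
  germ_range (germ_of s x) = theta s x.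
Proof.
move=> sx; have /germ_ofP := germE (germ_of s x).
case=> // [|_ [n /(_ x (cylinder_take n x))[_ _ ->]]]; first exact: germ_tripleP.
by rewrite /germ_range germ_sourceE.
Qed.

Lemma theta_cont s x n : cylinder (t_src s) x ->
  exists m, forall y, cylinder (take_inf m x) y ->
    cylinder (t_src s) y /\ cylinder (take_inf n (theta s x)) (theta s y).
Proof.
case: s => al g be /= sx; exists (size be + n) => y my.
have bey := cylinder_sub sx (leq_addr _ _) my; split=> //.
move/cylinderE: my; rewrite take_inf_size.
case: sx bey => x' _ <- [y' _ <-]; rewrite !take_cat_infD !theta_cat.
move/eqP; rewrite eqseq_cat // eqxx => /eqP E.
apply/(@cylinder_take_le n (size al + n)); first exact: leq_addl.
by apply/cylinderE; rewrite take_inf_size !take_cat_infD !take_act_inf E.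
Qed.

Lemma germ_mulE s t x : cylinder (t_src t) x -> cylinder (t_src s) (theta t x) ->
  exists2 u, triple_mul s t = Some u &
    germ_mul (germ_of s (theta t x)) (germ_of t x) = germ_of u x.
Proof.
move=> tx sx; have [u [uE ux uP]] := triple_mulP tx sx; exists u => //.
have := germE (germ_of s (theta t x)); have := germE (germ_of t x).
rewrite /germ_mul !germ_sourceE //.
have := germ_tripleP (germ_of t x); have := germ_tripleP (germ_of s (theta t x)).
rewrite !germ_sourceE //.
move: (germ_triple _) (germ_triple (germ_of t x)) => s' t' s'x t'x.
move=> /germ_ofP[]// _ [m Hm] /germ_ofP[]// _ [n Hn].
have [|v [-> vx vP]] := @triple_mulP s' t' x t'x.
  by have [_ _ <-] := Hm x (cylinder_take m x).
have [k Hk] := theta_cont n tx.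
apply/germ_ofP => //; split=> //.
exists (maxn (size (t_src u)) (maxn (size (t_src v)) (maxn m k))) => y Hy.
have uy : cylinder (t_src u) y by apply: cylinder_sub ux _ Hy; rewrite leq_maxl.
have vy : cylinder (t_src v) y.
  by apply: cylinder_sub vx _ Hy; rewrite !leq_max leqnn !orbT.
have my : cylinder (take_inf m x) y.
  by apply: cylinder_take_le Hy; rewrite !leq_max leqnn !orbT.
have ky : cylinder (take_inf k x) y.
  by apply: cylinder_take_le Hy; rewrite !leq_max leqnn !orbT.
split=> //; have [_ _ ->] := uP y uy; have [_ _ ->] := vP y vy.
have [_ _ <-] := Hm y my; have [_ /Hn[_ _ ->]//] := Hk y ky.
Qed.

Lemma germ_invE s x : cylinder (t_src s) x ->
  germ_inv (germ_of s x) = germ_of (triple_star s) (theta s x).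
Proof.
move=> sx; rewrite /germ_inv germ_rangeE //.
have := germE (germ_of s x); have := germ_tripleP (germ_of s x).
rewrite germ_sourceE //; move: (germ_triple _) => s' s'x /germ_ofP[]// _ [n Hn].
have E : theta s x = theta s' x by have [] := Hn x (cylinder_take n x).
apply/germ_ofP; first by rewrite E; exact: theta_tgt.
  exact: theta_tgt.
split=> //.
have [m Hm] := @theta_cont (triple_star s) (theta s x) n (theta_tgt s x).
have [m' Hm'] := @theta_cont (triple_star s') (theta s' x) n (theta_tgt s' x).
exists (maxn m m') => y ym.
have [sy ny] := Hm y (cylinder_take_le (leq_maxl _ _) ym).
rewrite thetaK // in ny.
rewrite -E in Hm'; have [s'y _] := Hm' y (cylinder_take_le (leq_maxr _ _) ym).
split=> //.
have starK r : triple_star (triple_star r) = r.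
  by case: r => al g be; rewrite /triple_star /= invgK.
have := thetaK sy; rewrite starK; have [_ _ ->] := Hn _ ny => {1}<-.
by rewrite thetaK //; have [] := Hn _ ny.
Qed.

(* Theta ((al, g, be), C(be eta)) for s = (al, g, be). *)
Definition basic_bisection (s : triple) (eta : word) : set germ :=
  germ_of s @` cylinder (t_src s ++ eta).

Definition germ_index := (triple * seq bool)%type.
HB.instance Definition _ := Choice.on germ_index.
HB.instance Definition _ := isPointed.Build germ_index (idem [::], [::]).

Definition germ_base (i : germ_index) : set germ := basic_bisection i.1 i.2.

Lemma cylinder_catl u v : cylinder (u ++ v) `<=` cylinder u.
Proof. by move=> _ [x _ <-]; rewrite cat_infA; eexists. Qed.

Lemma germ_base_cover : \bigcup_(i in [set: germ_index]) germ_base i = setT.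
Proof.
apply/seteqP; split=> // g _; exists (germ_triple g, [::]) => //.
exists (germ_source g); last exact/esym/germE.
by rewrite /= cats0; exact: germ_tripleP.
Qed.

Lemma germ_base_join (i j : germ_index) (g : germ) :
  [set: germ_index] i -> [set: germ_index] j ->
  germ_base i g -> germ_base j g ->
  exists k, [/\ [set: germ_index] k, germ_base k g
    & germ_base k `<=` germ_base i `&` germ_base j].
Proof.
case: i j => [s u] [t v] _ _ [x /= sx <-] [x' /= tx].
have sx1 := cylinder_catl sx; have tx1 := cylinder_catl tx.
move=> /(germ_ofP tx1 sx1)[E [n Hn]]; rewrite E in tx tx1 Hn.
set m := maxn n (maxn (size (t_src s ++ u)) (size (t_src t ++ v))).
have [nm sm tm] : [/\ n <= m, size (t_src s ++ u) <= m & size (t_src t ++ v) <= m].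
  by rewrite /m !leq_max !leqnn !orbT.
have mE : t_src s ++ drop (size (t_src s)) (take_inf m x) = take_inf m x.
  rewrite -{1}(_ : take (size (t_src s)) (take_inf m x) = t_src s) ?cat_take_drop //.
  rewrite take_inf_le ?(leq_trans _ sm) ?size_cat ?leq_addr //.
  exact/cylinderE.
exists (s, drop (size (t_src s)) (take_inf m x)); split=> //.
  by exists x => //=; rewrite mE; exact: cylinder_take.
move=> _ [y /= + <-]; rewrite mE => my.
have sy := cylinder_sub sx sm my; have ty := cylinder_sub tx tm my.
split; first by exists y.
exists y => //; apply/germ_ofP; [exact: cylinder_catl ty|exact: cylinder_catl sy|].
split=> //; exists m => z mz; apply: Hn.
have := cylinder_sub (cylinder_take n x) _ my; rewrite take_inf_size => /(_ nm).
move=> /cylinderE; rewrite take_inf_size => ny.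
by rewrite -ny; exact: cylinder_take_le mz.
Qed.

HB.instance Definition _ :=
  @isBaseTopological.Build germ germ_index setT germ_base
    germ_base_cover germ_base_join.

Lemma open_germE (A : set germ) : open A <->
  forall g, A g -> exists s eta,
    basic_bisection s eta g /\ basic_bisection s eta `<=` A.
Proof.
split.
  move=> [D' _ <-] g [[s eta] Di gi]; exists s, eta; split=> // h hh.
  by exists (s, eta).
move=> H; exists [set i | germ_base i `<=` A] => //.
apply/seteqP; split=> g; first by case=> i iA /iA.
by move=> /H[s [eta [gs sA]]]; exists (s, eta).
Qed.

Definition homeo_onto_open (X Y : topologicalType) (f : X -> Y) (U : set X) :=
  [/\ open (f @` U), {within U, continuous f} &
    exists g : Y -> X, {in U, cancel f g} /\ {within f @` U, continuous g}].

Definition open_bisection (U : set germ) :=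
  [/\ open U, homeo_onto_open germ_range U & homeo_onto_open germ_source U].

Definition compact_open_bisection (U : set germ) :=
  compact U /\ open_bisection U.

Section Algebra.
Variable K : fieldType.
Local Open Scope ring_scope.
Implicit Types f g : germ -> K.

Definition steinberg : set (germ -> K) :=
  [set f | exists (n : nat) (c : 'I_n -> K) (B : 'I_n -> set germ),
    (forall i, compact_open_bisection (B i)) /\
    f = fun x => \sum_(i < n) c i * \1_(B i) x].

(* For f and g in the Steinberg algebra only finitely many terms are nonzero. *)
Definition convolution f g : germ -> K := fun x =>
  \sum_(y \in [set y | germ_range y = germ_range x])
    f y * g (germ_mul (germ_inv y) x).

Definition singular : set (germ -> K) :=
  [set f | steinberg f /\
    exists (n : nat) (c : 'I_n -> K) (M : 'I_n -> set germ),
    [/\ trivIset [set: 'I_n] M,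
        forall i, (exists U C, [/\ open_bisection U, closed C & M i = U `&` C])
          /\ interior (M i) = set0 &
        f = fun x => \sum_(i < n) c i * \1_(M i) x]].

Definition steinberg_ideal (I : set (germ -> K)) :=
  [/\ I `<=` steinberg, I (fun=> 0),
      forall f g, I f -> I g -> I (fun x => f x + g x),
      forall k f, I f -> I (fun x => k * f x) &
      forall f g, steinberg f -> I g ->
        I (convolution f g) /\ I (convolution g f)].

Definition steinberg_simple :=
  forall I, steinberg_ideal I -> I = [set (fun=> 0)] \/ I = steinberg.

End Algebra.

(* Main.v *)
(* The elements e, b, c, d form a Klein four-group, and each of b, c, d moves    *)
(* words 1^m 0 w with m arbitrarily large, so their germs at 1^oo are pairwise   *)
(* distinct. At any other point, of prefix 1^m 0 say, the restrictions of        *)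
(* e, b, c, d to that prefix are e, e, a, a in some order, so the germs coincide *)
(* in pairs. Over the field with two elements, the sum of the indicators of the  *)
(* bisections of e, b, c, d is therefore the indicator of the four germs at      *)
(* 1^oo, which is singular and nonzero. It lies in the ideal of functions of the *)
(* Steinberg algebra that vanish on the germs whose source has infinitely many   *)
(* letters 0 (a set of sources invariant under the groupoid), but the indicator  *)
(* of the unit space does not.                                                   *)
Require Import Defs.
From mathcomp Require Import all_boot all_algebra.
From mathcomp Require Import boolp classical_sets functions cardinality fsbigop.
From mathcomp Require Import topology cantor numfun.
From mathcomp Require finmap.

Set Implicit Arguments.
Unset Strict Implicit.
Unset Printing Implicit Defensive.

Import GRing.Theory.
Local Open Scope classical_set_scope.

(** * Compact open bisections *)

(** The singular element is [klein_sum], the sum of the indicators of the bisections of e, b, c, d.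
    Away from [ones] their germs coincide in pairs ([klein_pairs]), so the sum vanishes there in
    characteristic 2 ([klein_sum_eq0]). At [ones] the four germs are distinct ([klein_germ_inj]), so
    what remains is the indicator of four points, each relatively closed in a bisection and with
    empty interior.

    For non-simplicity, the elements of the algebra vanishing over an invariant set of units form a
    two-sided ideal ([invariant_steinberg_ideal]). Elements of the group change only finitely many
    letters of an infinite word ([act_inf_tail]), so having infinitely many letters 0 is an
    invariant property. It fails at [ones], hence the ideal contains [klein_sum]; it holds at the
    word 000..., hence the ideal misses the indicator of the unit space.

    The technical cost is that the algebra must be closed under convolution, although the groupoid
    is not Hausdorff. Indicators of compact open bisections are first reduced to sums of indicators
    of sets [Theta s] ([steinbergP]); on these, convolution is the product of the inverse semigroup
    ([indic_convolution]). *)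

Definition Theta (s : triple) : set germ := germ_of s @` cylinder (t_src s).

Lemma mem_Theta t u z : cylinder (t_src u) z ->
  Theta t (germ_of u z) <-> cylinder (t_src t) z /\
    exists n, forall y, cylinder (take_inf n z) y ->
      [/\ cylinder (t_src u) y, cylinder (t_src t) y & theta u y = theta t y].
Proof.
move=> uz; split.
  case=> x tx /esym/(germ_ofP uz tx)[zx nP]; rewrite zx; split=> //.
  by rewrite -zx.
by case=> tz nP; exists z => //; apply/esym/germ_ofP.
Qed.

Lemma basic_bisection0 s : basic_bisection s [::] = Theta s.
Proof. by rewrite /basic_bisection cats0. Qed.

(** Restricting (al, g, be) to C(be eta) amounts to replacing it by (al g(eta), g|_eta, be eta), so
    the second index of the base can be absorbed into the triple. *)
Lemma basic_bisectionE s eta : exists u, basic_bisection s eta = Theta u.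
Proof.
case: s => al g be; exists (Triple (al ++ g eta) (restr g eta) (be ++ eta)).
have E y : cylinder (be ++ eta) y -> theta (Triple al g be) y =
    theta (Triple (al ++ g eta) (restr g eta) (be ++ eta)) y.
  move=> [x _ <-]; rewrite theta_cat cat_infA theta_cat act_inf_cat.
  by rewrite cat_infA.
have G x : cylinder (be ++ eta) x -> germ_of (Triple al g be) x =
    germ_of (Triple (al ++ g eta) (restr g eta) (be ++ eta)) x.
  move=> bx; apply/germ_ofP => //=; first exact: cylinder_catl bx.
  split=> //; exists (size (be ++ eta)) => y; rewrite (cylinderE _ _).1 // => Hy.
  by split; [exact: cylinder_catl Hy|exact: Hy|exact: E].
by apply/seteqP; split=> _ [x /= sx <-]; exists x => //; rewrite G.
Qed.

Lemma open_Theta s : open (Theta s).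
Proof.
apply/open_germE => g gs; exists s, [::].
by rewrite basic_bisection0; split.
Qed.

Lemma open_germP (A : set germ) g : open A -> A g ->
  exists s, Theta s g /\ Theta s `<=` A.
Proof.
move=> /open_germE/[apply] -[s [eta [gs sA]]].
by have [u uE] := basic_bisectionE s eta; exists u; rewrite -uE.
Qed.

(** * Continuity of germs, source and range *)

Lemma open_cylinder v : open (cylinder v).
Proof. by apply/open_infwordE => x vx; exists v; split. Qed.

Lemma nbhs_cylinder n (x : infword) : nbhs x (cylinder (take_inf n x)).
Proof.
by apply: open_nbhs_nbhs; split; [exact: open_cylinder|exact: cylinder_take].
Qed.

Lemma nbhs_cylinderP (x : infword) A : nbhs x A ->
  exists n, cylinder (take_inf n x) `<=` A.
Proof.
rewrite nbhsE => -[B [/open_infwordE oB Bx] BA].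
have [v [/cylinderE vx vB]] := oB _ Bx.
by exists (size v); rewrite vx => y /vB/BA.
Qed.

Lemma nbhs_germP g (A : set germ) : nbhs g A -> exists s, Theta s g /\ Theta s `<=` A.
Proof.
rewrite nbhsE => -[B [oB Bg] BA].
have [s [gs sB]] := open_germP oB Bg.
by exists s; split=> // h /sB/BA.
Qed.

Lemma compact_cylinder v : compact (cylinder v).
Proof.
apply: subclosed_compact cantor_space_compact _ => //.
rewrite -[cylinder v]setCK; apply: open_closedC; apply/open_infwordE => x nvx.
exists (take_inf (size v) x); split; first exact: cylinder_take.
move=> y /cylinderE; rewrite take_inf_size => yx /cylinderE; rewrite yx => vx.
by apply: nvx; apply/cylinderE.
Qed.

Lemma germ_of_continuous s x : cylinder (t_src s) x ->
  {for x, continuous (germ_of s)}.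
Proof.
move=> sx A /nbhs_germP[t [/(mem_Theta _ sx)[tx [n nP]] tA]].
apply: filterS (nbhs_cylinder n x) => y ny; apply: tA.
have [sy ty _] := nP _ ny; apply/(mem_Theta _ sy); split=> //.
exists n => z /cylinderE; rewrite take_inf_size => zy; apply: nP.
apply/cylinderE; rewrite take_inf_size zy.
by move/cylinderE: ny; rewrite take_inf_size.
Qed.

Lemma theta_continuous s x : cylinder (t_src s) x ->
  {for x, continuous (theta s)}.
Proof.
move=> sx A /nbhs_cylinderP[n nA]; have [m mP] := theta_cont n sx.
by apply: filterS (nbhs_cylinder m x) => y /mP[_ /nA].
Qed.

Lemma germ_source_continuous : continuous germ_source.
Proof.
move=> g A /nbhs_cylinderP[n nA].
rewrite (germE g); have := germ_tripleP g; move: (germ_triple g) => s sx.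
move: (germ_source g) sx nA => x sx nA.
(* [u] is [s] cut down to a prefix of [x] of length at least [n]: the same germ at [x], on a domain
   small enough to lie in [A]. *)
have [u [_ ux uP]] := triple_mul_idem sx (leq_maxr n (size (t_src s))).
have /= nx := cylinder_take (maxn n (size (t_src s))) x.
have : open_nbhs (germ_of s x) (Theta u).
  split; first exact: open_Theta.
  apply/mem_Theta => //; rewrite ux; split=> //.
  exists (maxn n (size (t_src s))) => y ny; split=> //.
    by apply: cylinder_sub sx _ ny; rewrite leq_maxr.
  by rewrite uP.
move/open_nbhs_nbhs; apply: filterS => _ [y uy <-]; apply: nA.
rewrite /= germ_sourceE //; apply: cylinder_take_le (leq_maxl _ (size (t_src s))) _.
by rewrite -ux.
Qed.

Lemma Theta_source s : germ_source @` Theta s = cylinder (t_src s).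
Proof.
apply/seteqP; split=> x; first by case=> _ [y sy <-] <-; rewrite germ_sourceE.
by move=> sx; exists (germ_of s x); rewrite ?germ_sourceE //; exists x.
Qed.

Lemma germ_range_Theta s g : Theta s g -> germ_range g = theta s (germ_source g).
Proof. by case=> x sx <-; rewrite germ_rangeE // germ_sourceE. Qed.

Lemma germ_of_source s g : Theta s g -> g = germ_of s (germ_source g).
Proof. by case=> x sx <-; rewrite germ_sourceE. Qed.

Lemma germ_source_Theta s g : Theta s g -> cylinder (t_src s) (germ_source g).
Proof. by case=> x sx <-; rewrite germ_sourceE. Qed.

Lemma Theta_range s : germ_range @` Theta s = cylinder (t_tgt s).
Proof.
rewrite -theta_image; apply/seteqP; split=> x.
  by case=> _ [y sy <-] <-; rewrite germ_rangeE //; exists y.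
by case=> y sy <-; exists (germ_of s y); rewrite ?germ_rangeE //; exists y.
Qed.

Lemma germ_range_continuous : continuous germ_range.
Proof.
move=> g A; have gs : Theta (germ_triple g) g.
  by exists (germ_source g); [exact: germ_tripleP|rewrite -germE].
rewrite (germ_range_Theta gs).
move=> /(theta_continuous (germ_source_Theta gs))/germ_source_continuous.
have : nbhs g (Theta (germ_triple g)).
  by apply: open_nbhs_nbhs; split=> //; exact: open_Theta.
apply: filterS2 => h hs /=.
by rewrite (germ_range_Theta hs).
Qed.

Lemma Theta_compact_open_bisection s : compact_open_bisection (Theta s).
Proof.
split.
  apply: continuous_compact; last exact: compact_cylinder.
  rewrite continuous_open_subspace; last exact: open_cylinder.
  by move=> x; rewrite inE; exact: germ_of_continuous.
split; first exact: open_Theta.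
- split; first by rewrite Theta_range; exact: open_cylinder.
    exact/continuous_subspaceT/germ_range_continuous.
  exists (germ_of s \o theta (triple_star s)); split.
    move=> g; rewrite inE => gs /=; rewrite (germ_range_Theta gs).
    by rewrite thetaK -?germ_of_source //; exact: germ_source_Theta.
  rewrite Theta_range continuous_open_subspace; last exact: open_cylinder.
  move=> x; rewrite inE => sx; apply: continuous_comp.
    exact: theta_continuous.
  exact/germ_of_continuous/(theta_tgt (triple_star s)).
- split; first by rewrite Theta_source; exact: open_cylinder.
    exact/continuous_subspaceT/germ_source_continuous.
  exists (germ_of s); split.
    by move=> g; rewrite inE => gs; rewrite -germ_of_source.
  rewrite Theta_source continuous_open_subspace; last exact: open_cylinder.
  by move=> x; rewrite inE; exact: germ_of_continuous.
Qed.

(** Two cylinders with a common point are nested, and an injective source map on [B] lifts this from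
    cylinders to the germs above them. *)
Lemma Theta_nested (B : set germ) s t g : {in B &, injective germ_source} ->
  Theta s `<=` B -> Theta t `<=` B -> Theta s g -> Theta t g ->
  Theta s `<=` Theta t \/ Theta t `<=` Theta s.
Proof.
move=> Binj.
wlog st : s t / size (t_src s) <= size (t_src t).
  move=> W; case: (leqP (size (t_src s)) (size (t_src t))) => [|/ltnW] st.
    exact: W.
  by move=> sB tB sg tg; case: (W _ _ st tB sB tg sg); [right|left].
move=> sB tB sg tg; right=> h th.
have sh : cylinder (t_src s) (germ_source h).
  apply: cylinder_sub (germ_source_Theta sg) st _.
  by rewrite (cylinderE _ _).1 ?germ_source_Theta //; exact: germ_source_Theta.
have sh' : Theta s (germ_of s (germ_source h)) by exists (germ_source h).
suff -> : h = germ_of s (germ_source h) by [].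
by apply: Binj; rewrite ?inE ?germ_sourceE //; [exact: tB|exact: sB].
Qed.

(** By nestedness a finite union inside [B] can be thinned to a disjoint one, whose indicator is a
    plain sum. If the head lies in a later set it is dropped; otherwise the later sets that meet it
    are dropped. *)
Lemma indic_union_Theta (K : fieldType) (B : set germ) (l : seq triple) :
  {in B &, injective germ_source} -> (forall s, s \in l -> Theta s `<=` B) ->
  exists l' : seq triple, forall g,
    (\1_([set h | exists2 s, s \in l & Theta s h]) g)%R
    = (\sum_(s <- l') \1_(Theta s) g)%R :> K.
Proof.
move=> Binj; have [n] := ubnP (size l); elim: n l => // n IH [|s l] /= ln lB.
  exists [::] => g; rewrite big_nil indicE memNset //.
  by case.
have [[t tl st]|nst] := pselect (exists2 t, t \in l & Theta s `<=` Theta t).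
  have [|l' l'P] := IH l ln; first by move=> u ul; apply: lB; rewrite inE ul orbT.
  exists l' => g; rewrite -l'P; congr (indic _ g).
  apply/seteqP; split=> h [u]; last by move=> ul; exists u => //; rewrite inE ul orbT.
  by rewrite inE => /orP[/eqP-> /st|]; [exists t|exists u].
(* Each triple removed here meets [Theta s] and does not contain it, so it lies inside [Theta s]. *)
pose l1 := [seq t <- l | `[< Theta s `&` Theta t = set0 >]].
have [||l' l'P] := IH l1.
- by apply: leq_ltn_trans (ln : size l < n); rewrite size_filter count_size.
- by move=> u; rewrite mem_filter => /andP[_ ul]; apply: lB; rewrite inE ul orbT.
exists (s :: l') => g; rewrite big_cons -l'P.
have [sg|nsg] := pselect (Theta s g).
  rewrite !indicE mem_set; last by exists s => //; rewrite mem_head.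
  rewrite mem_set // memNset ?GRing.addr0 // => -[t].
  rewrite mem_filter => /andP[/asboolP st tl] tg.
  by have : (Theta s `&` Theta t) g by []; rewrite st.
rewrite [X in (X + _)%R]indicE (memNset nsg) add0r; congr (_%:R)%R; congr nat_of_bool.
apply/idP/idP; rewrite !inE => -[t]; last first.
  by rewrite mem_filter => /andP[_ tl] tg; exists t => //; rewrite inE tl orbT.
rewrite inE => /orP[/eqP->//|tl] tg; exists t => //; rewrite mem_filter tl andbT.
apply/asboolP/seteqP; split=> // h [sh th].
have tB : Theta t `<=` B by apply: lB; rewrite inE tl orbT.
have [st|ts] := Theta_nested Binj (lB s (mem_head _ _)) tB sh th.
  by exfalso; apply: nst; exists t.
by exfalso; apply/nsg/ts.
Qed.

(** Compactness is used on the image of [B] under the source map, which is covered by finitely many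
    cylinders; injectivity of the source then recovers the germs of [B] themselves. *)
Lemma compact_open_bisection_cover B : compact_open_bisection B ->
  {in B &, injective germ_source} /\
  exists l : seq triple, (forall s, s \in l -> Theta s `<=` B) /\
    B = [set g | exists2 s, s \in l & Theta s g].
Proof.
move=> [cB [oB _ [_ _ [k [kK _]]]]].
have Binj : {in B &, injective germ_source} := can_in_inj kK.
split=> //.
have : compact (germ_source @` B).
  by apply: continuous_compact cB; exact/continuous_subspaceT/germ_source_continuous.
rewrite compact_cover => /(_ _ [set s | Theta s `<=` B] (fun s => cylinder (t_src s))).
case=> [s _|x [g Bg <-]|D DB Dc].
- exact: open_cylinder.
- have [s [sg sB]] := open_germP oB Bg.
  by exists s => //; exact: germ_source_Theta.
exists (finmap.enum_fset D); have DB' s : s \in finmap.enum_fset D -> Theta s `<=` B.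
  by move=> /DB; rewrite inE.
split=> //; apply/seteqP; split=> g; last by case=> s /DB'; exact.
move=> Bg; have [|s /= sD sg] := Dc (germ_source g); first by exists g.
have sg' : Theta s (germ_of s (germ_source g)) by exists (germ_source g).
exists s => //; suff -> : g = germ_of s (germ_source g) by [].
by apply: Binj; rewrite ?inE ?germ_sourceE //; exact: DB' sg'.
Qed.

(** * Linear combinations of indicators of basic bisections *)

Section Span.
Variable K : fieldType.
Local Open Scope ring_scope.
Implicit Types (f g : germ -> K) (l : seq (K * triple)).

Definition Theta_sum l : germ -> K := fun x => \sum_(p <- l) p.1 * \1_(Theta p.2) x.

Lemma steinberg_Theta_sum l : steinberg (Theta_sum l).
Proof.
exists (size l), (fun i => (tnth (in_tuple l) i).1),
  (fun i => Theta (tnth (in_tuple l) i).2).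
split=> [i|]; first exact: Theta_compact_open_bisection.
by apply/funext => x; rewrite /Theta_sum big_tnth.
Qed.

Lemma indic_Theta_sum B : compact_open_bisection B ->
  exists l, \1_B = Theta_sum l.
Proof.
move=> /compact_open_bisection_cover[Binj [l [lB ->]]].
have [l' l'P] := indic_union_Theta K Binj lB.
exists [seq (1, s) | s <- l']; apply/funext => x; rewrite l'P /Theta_sum big_map.
by apply: eq_bigr => s _; rewrite mul1r.
Qed.

Lemma Theta_sumZ c l :
  (fun x => c * Theta_sum l x) = Theta_sum [seq (c * p.1, p.2) | p <- l].
Proof.
apply/funext => x; rewrite /Theta_sum big_map mulr_sumr.
by apply: eq_bigr => p _; rewrite mulrA.
Qed.

Lemma Theta_sumD l1 l2 :
  (fun x => Theta_sum l1 x + Theta_sum l2 x) = Theta_sum (l1 ++ l2).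
Proof. by apply/funext => x; rewrite /Theta_sum big_cat. Qed.

Lemma Theta_sum_bigsum (I : Type) (r : seq I) (F : I -> germ -> K) :
  (forall i, exists l, F i = Theta_sum l) ->
  exists l, (fun x => \sum_(i <- r) F i x) = Theta_sum l.
Proof.
move=> FP; elim: r => [|i r [l IH]].
  by exists [::]; apply/funext => x; rewrite /Theta_sum !big_nil.
have [k kP] := FP i; exists (k ++ l); rewrite -Theta_sumD -IH -kP.
by apply/funext => x; rewrite big_cons.
Qed.

Lemma steinbergP f : steinberg f <-> exists l, f = Theta_sum l.
Proof.
split=> [[n [c [B [Bb ->]]]]|[l ->]]; last exact: steinberg_Theta_sum.
apply: Theta_sum_bigsum => i; have [l ->] := indic_Theta_sum (Bb i).
by rewrite Theta_sumZ; eexists.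
Qed.

End Span.

(** * Convolution *)

Lemma triple_starK : involutive triple_star.
Proof. by case=> al g be; rewrite /triple_star /= invgK. Qed.

Lemma thetaVK s x : cylinder (t_tgt s) x -> theta s (theta (triple_star s) x) = x.
Proof. by move=> sx; rewrite -{1}(triple_starK s) thetaK. Qed.

Lemma theta_src s x : cylinder (t_src s) (theta (triple_star s) x).
Proof. exact: (theta_tgt (triple_star s)). Qed.

(** A nonzero product means that the source word of [s] and the target word of [t] are comparable,
    so some point [p] lies in both cylinders; [triple_mulP] then applies at its preimage. *)
Lemma triple_mul_theta s t u : triple_mul s t = Some u ->
  forall y, cylinder (t_src u) y ->
    [/\ cylinder (t_src t) y, cylinder (t_src s) (theta t y)
      & theta u y = theta s (theta t y)].
Proof.
move=> uE.
have [p [tp sp]] : exists p, cylinder (t_tgt t) p /\ cylinder (t_src s) p.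
  case: s t uE => al g be [ga h nu] /=; case: ifP => [/prefixP[ep ->] _|_].
    exists (cat_inf (be ++ ep) (fun=> false)).
    by split; [exists (fun=> false)|rewrite cat_infA; eexists].
  case: ifP => // /prefixP[ep ->] _; exists (cat_inf (ga ++ ep) (fun=> false)).
  by split; [rewrite cat_infA; eexists|exists (fun=> false)].
rewrite -(thetaVK tp) in sp; have [v [vE _ vP]] := triple_mulP (theta_src t p) sp.
by move: vE; rewrite uE => -[->].
Qed.

(* The only element of [Theta s] with the same range as [g]; meaningful when *)
(* that range lies in [cylinder (t_tgt s)].                                  *)
Definition Theta_lift s g := germ_of s (theta (triple_star s) (germ_range g)).

Lemma Theta_liftP s g : cylinder (t_tgt s) (germ_range g) ->
  Theta s (Theta_lift s g) /\ germ_range (Theta_lift s g) = germ_range g.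
Proof.
move=> sg; have sg' := theta_src s (germ_range g).
split; first by exists (theta (triple_star s) (germ_range g)).
by rewrite germ_rangeE // thetaVK.
Qed.

Lemma Theta_lift_uniq s g h : Theta s h -> germ_range h = germ_range g ->
  cylinder (t_tgt s) (germ_range g) /\ h = Theta_lift s g.
Proof.
rewrite /Theta_lift => sh <-; have sh' := germ_source_Theta sh.
rewrite (germ_range_Theta sh); split; first exact: theta_tgt.
by rewrite thetaK // -germ_of_source.
Qed.

(** Pointwise form of the rule that [Theta s] times [Theta t] is [Theta] of the product. With y the
    lift of g, the germ of the inverse of y times g is that of [theta u] followed by the inverse of
    [theta s]; this agrees locally with [theta t] exactly when [theta u] agrees with [theta s] after
    [theta t]. *)
Lemma Theta_lift_mul s t g : cylinder (t_tgt s) (germ_range g) ->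
  Theta t (germ_mul (germ_inv (Theta_lift s g)) g) <->
  exists2 u, triple_mul s t = Some u & Theta u g.
Proof.
rewrite /Theta_lift (germE g); have := germ_tripleP g.
move: (germ_triple g) (germ_source g) => u z uz; rewrite germ_rangeE // => suz.
have suz' := theta_src s (theta u z).
rewrite germ_invE // thetaVK //.
have [v vE ->] := @germ_mulE (triple_star s) u z uz suz.
have [? []] := @triple_mulP (triple_star s) u z uz suz; rewrite vE => -[<-] vz vP.
rewrite mem_Theta //; split.
  move=> [tz [n nP]].
  have tsz : cylinder (t_src s) (theta t z).
    have [_ _ <-] := nP z (cylinder_take n z).
    by have [_ _ ->] := vP z vz.
  have [w [wE wz wP]] := triple_mulP tz tsz.
  exists w => //; apply/mem_Theta => //; split=> //.
  exists (maxn n (size (t_src w))) => y yP.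
  have [vy ty vty] := nP y (cylinder_take_le (leq_maxl _ _) yP).
  have wy : cylinder (t_src w) y by apply: cylinder_sub wz _ yP; rewrite leq_maxr.
  have [uy suy vyE] := vP y vy.
  have [_ _ ->] := wP y wy; split=> //.
  by rewrite -vty vyE thetaVK.
move=> [w wE /(mem_Theta _ uz)[wz [n nP]]].
have wP := triple_mul_theta wE; have [tz _ _] := wP z wz.
split=> //; exists (maxn n (size (t_src v))) => y yP.
have [uy wy uwy] := nP y (cylinder_take_le (leq_maxl _ _) yP).
have vy : cylinder (t_src v) y by apply: cylinder_sub vz _ yP; rewrite leq_maxr.
have [ty sty wyE] := wP y wy; split=> //.
have [_ _ ->] := vP y vy.
by rewrite uwy wyE thetaK.
Qed.

Lemma germ_source_mulV y x : germ_range y = germ_range x ->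
  germ_source (germ_mul (germ_inv y) x) = germ_source x.
Proof.
rewrite (germE y) (germE x).
have := germ_tripleP y; have := germ_tripleP x.
move: (germ_triple y) (germ_source y) (germ_triple x) (germ_source x).
move=> s z u w uw sz; rewrite !germ_rangeE // => E.
rewrite germ_invE // E.
have sw : cylinder (t_src (triple_star s)) (theta u w) by rewrite -E; exact: theta_tgt.
have [v vE ->] := germ_mulE uw sw.
have [? []] := triple_mulP uw sw; rewrite vE => -[<-] vw _.
by rewrite !germ_sourceE.
Qed.

Section Convolution.
Variable K : fieldType.
Local Open Scope ring_scope.
Implicit Types (f g : germ -> K) (l : seq (K * triple)).

(** Each [Theta s] has at most one germ with the range of [x], namely [Theta_lift s x], so the sum
    over the whole range fibre collapses to one term per triple. *)
Lemma convolution_Theta_sum l g x : convolution (Theta_sum l) g x =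
  \sum_(p <- l) p.1 * (\1_(cylinder (t_tgt p.2)) (germ_range x) *
    g (germ_mul (germ_inv (Theta_lift p.2 x)) x)).
Proof.
pose F := [set y | germ_range y = germ_range x].
(* [Y] is finite and contains every germ of the fibre at which [Theta_sum l] can be nonzero. *)
pose Y := F `&` [set` [seq Theta_lift p.2 x | p <- l]].
have Yfin : finite_set Y.
  by apply: sub_finite_set (finite_seq [seq Theta_lift p.2 x | p <- l]) => y [].
rewrite /convolution -(@fsbig_widen _ _ _ _ Y F) //; first last.
- move=> y [Fy nYy] /=; rewrite /Theta_sum big_seq big1 ?mul0r // => p pl.
  rewrite indicE memNset ?mulr0 // => py; apply: nYy; split=> //=.
  by have [_ ->] := Theta_lift_uniq py Fy; exact: map_f.
- by move=> y [].
rewrite fsbig_finite //=.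
under eq_bigr do rewrite mulr_suml.
rewrite exchange_big /= big_seq [RHS]big_seq; apply: eq_bigr => p pl.
under eq_bigr do rewrite -mulrA.
rewrite -mulr_sumr -fsbig_finite //=; congr (_ * _).
have [px|npx] := pselect (cylinder (t_tgt p.2) (germ_range x)); last first.
  rewrite [in RHS]indicE (memNset npx) mul0r fsbig1 // => y [Fy _].
  rewrite indicE memNset ?mul0r // => py; apply: npx.
  by have [] := Theta_lift_uniq py Fy.
have [lp lF] := Theta_liftP px.
rewrite -(@fsbig_widen _ _ _ _ [set Theta_lift p.2 x] Y).
- by rewrite fsbig_set1 !indicE !mem_set.
- by move=> _ ->; split=> //=; exact: map_f.
move=> y [[Fy _] nyl] /=; rewrite indicE memNset ?mul0r // => py.
by apply: nyl; have [_ ->] := Theta_lift_uniq py Fy.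
Qed.

(** The list consists of the product of [s] and [t], or is empty when that product is 0. The
    cylinder factor discards the points where [Theta_lift] is meaningless, and the product bisection
    has no germ above them. *)
Lemma indic_convolution s t : exists l, forall x,
  \1_(cylinder (t_tgt s)) (germ_range x) *
    \1_(Theta t) (germ_mul (germ_inv (Theta_lift s x)) x) = Theta_sum l x :> K.
Proof.
have cyl u x : triple_mul s t = Some u -> Theta u x ->
    cylinder (t_tgt s) (germ_range x).
  move=> /triple_mul_theta uP ux; rewrite (germ_range_Theta ux).
  by have [_ sx ->] := uP _ (germ_source_Theta ux); exact: theta_tgt.
case E : (triple_mul s t) => [u|].
  exists [:: (1, u)] => x; rewrite /Theta_sum big_seq1 mul1r.
  have [sx|nsx] := pselect (cylinder (t_tgt s) (germ_range x)); last first.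
    rewrite indicE (memNset nsx) mul0r indicE memNset // => ux.
    exact/nsx/(cyl u).
  rewrite indicE mem_set // mul1r !indicE; congr (_%:R); congr nat_of_bool.
  apply/idP/idP; rewrite !inE Theta_lift_mul // E; first by case=> ? [<-].
  by move=> ux; exists u.
exists [::] => x; rewrite /Theta_sum big_nil.
have [sx|nsx] := pselect (cylinder (t_tgt s) (germ_range x)); last first.
  by rewrite indicE (memNset nsx) mul0r.
rewrite mulrC indicE memNset ?mul0r // => /(Theta_lift_mul _ sx)[u].
by rewrite E.
Qed.

Lemma steinberg_convolution f g :
  steinberg f -> steinberg g -> steinberg (convolution f g).
Proof.
move=> /steinbergP[l ->] /steinbergP[k ->]; apply/steinbergP.
pose F (p : K * triple) x := p.1 * (\1_(cylinder (t_tgt p.2)) (germ_range x) *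
  Theta_sum k (germ_mul (germ_inv (Theta_lift p.2 x)) x)).
have -> : convolution (Theta_sum l) (Theta_sum k) = fun x => \sum_(p <- l) F p x.
  by apply/funext => x; exact: convolution_Theta_sum.
apply: Theta_sum_bigsum => p.
pose G (q : K * triple) x := q.1 * (\1_(cylinder (t_tgt p.2)) (germ_range x) *
  \1_(Theta q.2) (germ_mul (germ_inv (Theta_lift p.2 x)) x)).
have [|m mE] := @Theta_sum_bigsum K _ k G.
  move=> q; have [m mP] := indic_convolution p.2 q.2.
  exists [seq (q.1 * r.1, r.2) | r <- m]; rewrite -Theta_sumZ.
  by apply/funext => x; rewrite /G mP.
exists [seq (p.1 * r.1, r.2) | r <- m]; rewrite -Theta_sumZ -mE.
apply/funext => x; rewrite /F /Theta_sum !mulr_sumr.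
by apply: eq_bigr => q _; rewrite /G !(mulrCA q.1).
Qed.

(** In each term of a convolution at x, the second argument has the source of x, and the first has
    the range of x, hence by invariance a source satisfying [P] as soon as x has one. So every term
    vanishes, whichever factor lies in the ideal. *)
Lemma invariant_steinberg_ideal (P : infword -> Prop) :
  (forall x, P (germ_range x) <-> P (germ_source x)) ->
  steinberg_ideal [set f : germ -> K |
    steinberg f /\ forall x, P (germ_source x) -> f x = 0].
Proof.
move=> Pinv; split.
- by move=> f [].
- split=> //; apply/steinbergP; exists [::].
  by apply/funext => x; rewrite /Theta_sum big_nil.
- move=> f g [/steinbergP[l ->] fP] [/steinbergP[k ->] gP]; split.
    by apply/steinbergP; rewrite Theta_sumD; eexists.
  by move=> x Px; rewrite fP // gP // addr0.
- move=> c f [/steinbergP[l ->] fP]; split.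
    by apply/steinbergP; rewrite Theta_sumZ; eexists.
  by move=> x Px; rewrite fP // mulr0.
move=> f g fS [gS gP]; split; split; try exact: steinberg_convolution.
  move=> x Px; apply: fsbig1 => y /= yx.
  by rewrite gP ?mulr0 // germ_source_mulV.
move=> x Px; apply: fsbig1 => y /= yx.
by rewrite gP ?mul0r //; apply/Pinv; rewrite yx; apply/Pinv.
Qed.

End Convolution.

(** * The singular element *)

Definition gen_b := Grigorchuk in_grigb.
Definition gen_c := Grigorchuk in_grigc.
Definition gen_d := Grigorchuk in_grigd.

Definition klein (i : nat) : grigorchuk :=
  nth grig_one [:: grig_one; gen_b; gen_c; gen_d] i.

Definition root_triple (g : grigorchuk) := Triple [::] g [::].

Lemma cylinder0 x : cylinder [::] x.
Proof. exact/cylinderE. Qed.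

Lemma theta_root g x : theta (root_triple g) x = act_inf g x.
Proof. by apply/funext => n; rewrite /theta /cat_inf subn0 nth_nil. Qed.

(** Makes equality of germs a matter of finite words, on which the generators can be evaluated. *)
Lemma germ_of_root_eq g h x :
  germ_of (root_triple g) x = germ_of (root_triple h) x <->
  exists n, forall w, g (take_inf n x ++ w) = h (take_inf n x ++ w).
Proof.
have [gx hx] : cylinder (t_src (root_triple g)) x /\ cylinder (t_src (root_triple h)) x.
  by split; exact: cylinder0.
split=> [/(germ_ofP gx hx)[_ [n nP]]|[n nP]].
  exists n => w; have nx : cylinder (take_inf n x)
      (cat_inf (take_inf n x ++ w) (fun=> false)) by rewrite cat_infA; eexists.
  have [_ _] := nP _ nx; rewrite !theta_root.
  move/(congr1 (take_inf (size (take_inf n x ++ w)))).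
  by rewrite !take_act_inf take_cat_inf.
apply/germ_ofP => //; split=> //; exists n => y [z _ <-].
split; [exact: cylinder0..|]; rewrite !theta_root !act_inf_cat.
have E := nP [::]; rewrite !cats0 in E; rewrite E; congr cat_inf; congr act_inf.
apply: grig_ext => w; have /eqP := nP w.
by rewrite !restr_cat E eqseq_cat // eqxx => /eqP.
Qed.

(* The cycle b -> c -> d -> b of restrictions at the letter 1 has length 3. *)
Lemma klein_ones i k u :
  klein i (nseq (3 * k) true ++ u) = nseq (3 * k) true ++ klein i u.
Proof.
have bcd : [/\ grig_b (nseq (3 * k) true ++ u) = nseq (3 * k) true ++ grig_b u,
    grig_c (nseq (3 * k) true ++ u) = nseq (3 * k) true ++ grig_c u
    & grig_d (nseq (3 * k) true ++ u) = nseq (3 * k) true ++ grig_d u].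
  elim: k => [//|k [b c d]]; rewrite mulnS /=.
  by rewrite b c d.
by case: bcd => b c d; case: i => [|[|[|[|[|i]]]]].
Qed.

Definition ones : infword := fun=> true.

Lemma take_ones n : take_inf n ones = nseq n true.
Proof.
apply: (@eq_from_nth _ false); rewrite take_inf_size ?size_nseq // => i lin.
by rewrite nth_mkseq // nth_nseq lin.
Qed.

Lemma klein_germ_inj (i j : 'I_4) :
  germ_of (root_triple (klein i)) ones = germ_of (root_triple (klein j)) ones -> i = j.
Proof.
move=> /germ_of_root_eq[n]; rewrite take_ones => nP.
(* The last letter of 00 is flipped by b and c only, and that of 100 by b and d only, so [u 0] and
   [u 1] separate the four elements. *)
pose u r := nseq r true ++ [:: false; false].
have {nP} uP r : klein i (u r) = klein j (u r).
  (* Another 2n letters 1 complete the prefix to length 3n, a multiple of the period, which all four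
     elements pass unchanged. *)
  have := nP (nseq (2 * n) true ++ u r).
  rewrite catA -nseqD -mulSn !klein_ones => /eqP.
  by rewrite eqseq_cat // eqxx => /eqP.
apply/eqP; move: (uP 0) (uP 1); case: i j {uP} => [[|[|[|[|//]]]] ?].
all: by case=> [[|[|[|[|//]]]] ?].
Qed.

Lemma take_first_false (x : infword) : x <> ones ->
  exists m, take_inf m.+1 x = nseq m true ++ [:: false].
Proof.
move=> xN; have ex : exists i, ~~ x i.
  apply: contrapT => /forallNP nx; apply: xN; apply/funext => i.
  by apply/negPn/negP => /nx.
case: (ex_minnP ex) => m xm mmin; exists m.
rewrite /take_inf mkseqS -cats1 (negbTE xm); congr (_ ++ _).
rewrite -take_ones; apply/eq_in_map => i; rewrite mem_iota add0n => /= im.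
by apply/negPn/negP => /mmin; rewrite leqNgt im.
Qed.

(** If the first 0 of [x] is at position m, the restrictions of e, b, c, d to the prefix 1^m 0
    depend only on m modulo 3: they are e, a, a, e, then e, a, e, a, then e, e, a, a. These are the
    third, second and first alternatives. *)
Lemma klein_pairs x : x <> ones ->
  let k i := germ_of (root_triple (klein i)) x in
  [\/ k 0 = k 1 /\ k 2 = k 3, k 0 = k 2 /\ k 1 = k 3 | k 0 = k 3 /\ k 1 = k 2].
Proof.
move=> /take_first_false[m mE] /=.
have H i j : (forall w, klein i (nseq (m %% 3) true ++ false :: w)
      = klein j (nseq (m %% 3) true ++ false :: w)) ->
    germ_of (root_triple (klein i)) x = germ_of (root_triple (klein j)) x.
  move=> ij; apply/germ_of_root_eq; exists m.+1 => w.
  rewrite mE -catA {1 2}(divn_eq m 3) mulnC nseqD -catA /=.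
  by rewrite !klein_ones ij.
have : m %% 3 < 3 by rewrite ltn_mod.
case: (m %% 3) H => [|[|[|//]]] H _.
- by apply: Or33; split; apply: H.
- by apply: Or32; split; apply: H.
- by apply: Or31; split; apply: H.
Qed.

Lemma closed_set1_infword (x : infword) : closed [set x].
Proof. exact/accessible_closed_set1/hausdorff_accessible/cantor_space_hausdorff. Qed.

Lemma interior_set1_germ (g : germ) : interior [set g] = set0.
Proof.
apply/seteqP; split=> // h /nbhs_germP[s [_ sg]].
(* A bisection [Theta s] inside the singleton would force all points of a cylinder to equal one
   source. *)
have sE b : germ_source g = cat_inf (t_src s) (fun=> b).
  rewrite -(sg (germ_of s (cat_inf (t_src s) (fun=> b)))); last first.
    by exists (cat_inf (t_src s) (fun=> b)) => //; eexists.
  by rewrite germ_sourceE //; eexists.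
have /cat_infI := etrans (esym (sE true)) (sE false).
by move/(congr1 (@^~ 0)).
Qed.

(** The source is injective on [Theta s], so the point is cut out by a fibre of the source map,
    which is closed by continuity. *)
Lemma set1_bisection_closed s g : Theta s g ->
  exists U C, [/\ open_bisection U, closed C & [set g] = U `&` C].
Proof.
move=> sg; exists (Theta s), (germ_source @^-1` [set germ_source g]); split.
- by have [] := Theta_compact_open_bisection s.
- apply: preimage_closed; last exact: closed_set1_infword.
  by move=> x _; exact: germ_source_continuous.
apply/seteqP; split=> [_ ->//|h [sh /= hg]].
by rewrite (germ_of_source sh) hg -germ_of_source.
Qed.

(** * The four-term sum in characteristic two *)

Section KleinSum.
Local Open Scope ring_scope.

Definition klein_sum : germ -> 'F_2 :=
  fun g => \sum_(i < 4) \1_(Theta (root_triple (klein i))) g.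

Lemma addbb_F2 (t : 'F_2) : t + t = 0.
Proof. by apply/val_inj; case: t => [[|[|]]]. Qed.

Lemma Theta_root h g :
  Theta (root_triple h) g <-> g = germ_of (root_triple h) (germ_source g).
Proof.
split=> [/germ_of_source//|->].
by exists (germ_source g) => //; exact: cylinder0.
Qed.

Lemma klein_sum_eq0 g : germ_source g <> ones -> klein_sum g = 0.
Proof.
move=> gN; rewrite /klein_sum !big_ord_recr /= big_ord0 add0r.
have H i j : germ_of (root_triple (klein i)) (germ_source g) =
    germ_of (root_triple (klein j)) (germ_source g) ->
    \1_(Theta (root_triple (klein i))) g = \1_(Theta (root_triple (klein j))) g :> 'F_2.
  move=> ij; rewrite !indicE; congr (_%:R); congr nat_of_bool.
  by apply/idP/idP; rewrite !inE !Theta_root ij.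
case: (klein_pairs gN) => -[/H e1 /H e2].
- by rewrite e1 e2 addbb_F2 add0r addbb_F2.
- by rewrite e1 e2 -addrA addbb_F2.
by rewrite e1 e2 -(addrA _ _ (\1_(Theta (root_triple (klein 2))) g)) addbb_F2 addr0 addbb_F2.
Qed.

Definition klein_germ (i : nat) : germ := germ_of (root_triple (klein i)) ones.

Lemma klein_germ_source i : germ_source (klein_germ i) = ones.
Proof. by rewrite germ_sourceE //; exact: cylinder0. Qed.

Lemma klein_sumE :
  klein_sum = fun g => \sum_(i < 4) 1 * \1_([set klein_germ i]) g.
Proof.
apply/funext => g; have [gE|gN] := pselect (germ_source g = ones).
  apply: eq_bigr => i _; rewrite mul1r !indicE; congr (_%:R); congr nat_of_bool.
  by apply/idP/idP; rewrite !inE Theta_root gE.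
rewrite klein_sum_eq0 // big1 // => i _.
rewrite indicE memNset ?mulr0 // => /= gE; apply: gN.
by rewrite gE klein_germ_source.
Qed.

Lemma klein_sum_steinberg : steinberg klein_sum.
Proof.
exists 4%N, (fun=> 1), (fun i => Theta (root_triple (klein i))).
split=> [i|]; first exact: Theta_compact_open_bisection.
by apply/funext => g; apply: eq_bigr => i _; rewrite mul1r.
Qed.

Lemma klein_sum_singular : singular klein_sum.
Proof.
split; first exact: klein_sum_steinberg.
exists 4%N, (fun=> 1), (fun i => [set klein_germ i]); split.
- move=> i j _ _ [g [/= -> /klein_germ_inj]]; exact.
- move=> i; split; last exact: interior_set1_germ.
  apply: (@set1_bisection_closed (root_triple (klein i))).
  by apply/Theta_root; rewrite klein_germ_source.
exact: klein_sumE.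
Qed.

Lemma klein_sum_neq0 : klein_sum <> (fun=> 0).
Proof.
move/(congr1 (@^~ (klein_germ 0))); rewrite klein_sumE (bigD1 ord0) //=.
rewrite indicE mem_set // mulr1 big1 ?addr0; first by move/eqP; rewrite oner_eq0.
move=> i i0; rewrite indicE memNset ?mulr0 //= => /(@klein_germ_inj ord0 i) i0E.
by rewrite -i0E eqxx in i0.
Qed.

End KleinSum.

(** * Tails under the action *)

(** Up to and including the first 0 the generators b, c, d copy their input, and then they change at
    most the next letter. The default [true] forces the 0 at position [j] to be a letter of [w]. *)
Lemma gen_tail (g : word -> word) :
  g = grig_b \/ g = grig_c \/ g = grig_d -> forall w i j,
  j.+1 < i -> i < size w -> nth true w j = false -> nth false (g w) i = nth false w i.
Proof.
suff bcd w : forall i j, j.+1 < i -> i < size w -> nth true w j = false ->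
    [/\ nth false (grig_b w) i = nth false w i,
        nth false (grig_c w) i = nth false w i &
        nth false (grig_d w) i = nth false w i].
  by move=> gE w i j ji iw /(bcd w i j ji iw)[b c d]; case: gE => [->|[->|->]].
elim: w => [//|[] w IH] [//|i] j /=.
  case: j => [//|j] ji iw /(IH i j ji iw)[b c d]; split; [exact: c|exact: d|exact: b].
move=> ji iw _; case: i ji iw => [//|i] _ iw.
by split=> //; case: w {IH} iw.
Qed.

Lemma gen_act_inf_tail h (hP : in_grig h) x :
  h = grig_b \/ h = grig_c \/ h = grig_d ->
  exists n, forall i, n <= i -> act_inf (Grigorchuk hP) x i = x i.
Proof.
move=> hE; have [xE|/take_first_false[m mE]] := pselect (x = ones).
  exists 0 => i _; rewrite xE /act_inf take_ones /=.
  have bcd k : [/\ grig_b (nseq k true) = nseq k true,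
      grig_c (nseq k true) = nseq k true & grig_d (nseq k true) = nseq k true].
    by elim: k => [//|k [b c d]]; split=> /=; rewrite ?b ?c ?d.
  have [b c d] := bcd i.+1.
  by case: hE => [->|[->|->]]; rewrite ?b ?c ?d nth_nseq ltnSn.
(* The first 0 is at position m, so only the letter at position m+1 can change. *)
exists m.+2 => i mi; rewrite /act_inf /= (gen_tail hE (j := m)) //.
- by rewrite nth_mkseq.
- by rewrite take_inf_size.
rewrite nth_mkseq; last by rewrite ltnS ltnW // ltnW.
have := congr1 (nth true ^~ m) mE; rewrite nth_mkseq // => ->.
by rewrite nth_cat size_nseq ltnn subnn.
Qed.

Lemma act_inf_tail (g : grigorchuk) x :
  exists n, forall i, n <= i -> act_inf g x i = x i.
Proof.
case: g => g gP; suff : forall (P : in_grig g) x,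
    exists n, forall i, n <= i -> act_inf (Grigorchuk P) x i = x i by apply.
elim: gP => {g x} [|||||g h gP IHg hP IHh|g h gP IHg gK hK] P x.
- by exists 0 => i _; rewrite (grig_ext (g := Grigorchuk P) (h := 1%g)) // act_inf1.
- exists 1 => -[//|i] _.
  have aE w : nth false (grig_a w) i.+1 = nth false w i.+1 by case: w.
  by rewrite [LHS]aE nth_mkseq.
- by apply: gen_act_inf_tail; left.
- by apply: gen_act_inf_tail; right; left.
- by apply: gen_act_inf_tail; right; right.
- rewrite (grig_ext (g := Grigorchuk P) (h := (Grigorchuk gP * Grigorchuk hP)%g)) //.
  have [m mP] := IHh hP x; have [n nP] := IHg gP (act_inf (Grigorchuk hP) x).
  exists (maxn m n) => i; rewrite geq_max => /andP[mi ni].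
  by rewrite act_infM nP // mP.
(* For an inverse, the hypothesis on [g] is used at the image of [x], which [g] sends back to
   [x]. *)
have [n nP] := IHg gP (act_inf (Grigorchuk P) x).
exists n => i /nP <-; rewrite -act_infM.
rewrite (_ : (_ * _)%g = 1%g) ?act_inf1 //.
by apply: grig_ext => w /=; rewrite hK.
Qed.

(** A property insensitive to shifts and to finite changes, as invariance under germs requires, that
    separates 000... from [ones]. *)
Definition infinitely_many_false (x : infword) :=
  forall n, exists2 i, n <= i & x i = false.

Lemma infinitely_many_false_tail (x y : infword) m n :
  (forall i, n <= i -> y (m + i) = x i) ->
  infinitely_many_false y <-> infinitely_many_false x.
Proof.
move=> xy; split=> H k.
  have [i mnk yi] := H (m + maxn n k).
  have mi : m <= i := leq_trans (leq_addr _ _) mnk.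
  move: mnk; rewrite -leq_subRL // geq_max => /andP[ni ki].
  by exists (i - m) => //; rewrite -xy // subnKC.
have [i] := H (maxn n k); rewrite geq_max => /andP[ni ki] xi.
by exists (m + i); [exact: leq_trans ki (leq_addl _ _)|rewrite xy].
Qed.

Lemma infinitely_many_false_cat v x :
  infinitely_many_false (cat_inf v x) <-> infinitely_many_false x.
Proof.
apply: (@infinitely_many_false_tail _ _ (size v) 0) => i _.
by rewrite -[in RHS](drop_cat_inf v x).
Qed.

Lemma infinitely_many_false_act (g : grigorchuk) x :
  infinitely_many_false (act_inf g x) <-> infinitely_many_false x.
Proof.
have [n nP] := act_inf_tail g x.
by apply: (@infinitely_many_false_tail _ _ 0 n) => i /nP.
Qed.

Lemma infinitely_many_false_germ g :
  infinitely_many_false (germ_range g) <-> infinitely_many_false (germ_source g).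
Proof.
rewrite /germ_range; have := germ_tripleP g.
case: (germ_triple g) => al h be /= [x _ <-].
by rewrite theta_cat !infinitely_many_false_cat infinitely_many_false_act.
Qed.

Theorem corollary5p26 :
  (exists f : germ -> 'F_2, singular f /\ f <> (fun=> 0%R)) /\
  ~ steinberg_simple 'F_2.
Proof.
split.
  by exists klein_sum; split; [exact: klein_sum_singular|exact: klein_sum_neq0].
move=> /(_ _ (invariant_steinberg_ideal 'F_2 infinitely_many_false_germ))[] E.
  apply: klein_sum_neq0.
  suff : [set fun=> 0%R] klein_sum by [].
  rewrite -E; split; first exact: klein_sum_steinberg.
  move=> g Pg; apply: klein_sum_eq0 => gE.
  by have [i _] := Pg 0; rewrite gE.
(* The indicator of the unit space has value 1 at the unit germ of 000..., where every element of
   the ideal vanishes. *)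
have := steinberg_Theta_sum [:: (1%R : 'F_2, root_triple grig_one)].
rewrite -E => -[_ /(_ (germ_of (root_triple grig_one) (fun=> false)))].
have zc : cylinder (t_src (root_triple grig_one)) (fun=> false) by exact: cylinder0.
rewrite germ_sourceE // /Theta_sum big_seq1 indicE mem_set; last by exists (fun=> false).
by rewrite mulr1 => H; have /eqP := H (fun n => ex_intro2 _ _ n (leqnn n) erefl).
Qed.
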